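(* For any hereditary QF-$3^{+}$ ring $\Lambda$, there is a bimorphism (i.e., a morphism that is both an epimorphism and a monomorphism) in the category of associative rings with identity from $\Lambda$ to a semisimple left Artinian ring.
   Context: A ring $\Lambda$ is left QF-$3^{+}$ if the injective envelope of the left module ${}_\Lambda\Lambda$ is projective; a left hereditary left QF-$3^{+}$ ring is also right hereditary and right QF-$3^{+}$, so one speaks of hereditary QF-$3^{+}$ rings. Morphisms of rings preserve the identity. *)

(* Defs.v *)
From HB Require Import structures.
From mathcomp Require Import all_boot all_order all_algebra.

Set Implicit Arguments.
Unset Strict Implicit.
Unset Printing Implicit Defensive.

Import GRing.Theory.
Local Open Scope ring_scope.

(* Rings are pzRingTypes, so the zero ring is allowed.  Submodules are boolean
   predicates closed under the module operations; classically every subset is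
   of this form. *)

Definition projective (R : pzRingType) (P : lmodType R) : Prop :=
  forall (M N : lmodType R) (p : {linear M -> N}) (f : {linear P -> N}),
    (forall y, exists x, p x = y) ->
    exists g : {linear P -> M}, p \o g =1 f.

Definition injective_module (R : pzRingType) (E : lmodType R) : Prop :=
  forall (M N : lmodType R) (i : {linear M -> N}) (f : {linear M -> E}),
    injective i ->
    exists g : {linear N -> E}, g \o i =1 f.

Definition essential_embedding (R : pzRingType) (M E : lmodType R)
    (i : {linear M -> E}) : Prop :=
  injective i /\
  forall S : {pred E}, submod_closed S ->
    (exists2 x, x \in S & x != 0) ->
    exists2 m, i m \in S & i m != 0.

Definition injective_envelope (R : pzRingType) (M E : lmodType R)
    (i : {linear M -> E}) : Prop :=
  injective_module E /\ essential_embedding i.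

(* Left ideals are given, up to isomorphism, as modules M with an injective
   linear map into the left regular module R^o. *)
Definition left_hereditary (R : pzRingType) : Prop :=
  forall (M : lmodType R) (i : {linear M -> R^o}), injective i -> projective M.

(* The injective envelope exists and is unique up to isomorphism, so it does
   not matter which one is chosen. *)
Definition left_QF3plus (R : pzRingType) : Prop :=
  exists (E : lmodType R) (i : {linear R^o -> E}),
    injective_envelope i /\ projective E.

Definition simple_submodule (R : pzRingType) (M : lmodType R)
    (S : {pred M}) : Prop :=
  [/\ submod_closed S,
      exists2 x, x \in S & x != 0
    & forall T : {pred M}, submod_closed T -> {subset T <= S} ->
        T =i pred1 0 \/ T =i S].

(* M is the sum of its simple submodules. *)
Definition semisimple_module (R : pzRingType) (M : lmodType R) : Prop :=
  forall x : M, exists (n : nat) (S : 'I_n -> {pred M}) (y : 'I_n -> M),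
    (forall k, simple_submodule (S k) /\ y k \in S k) /\
    x = \sum_(k < n) y k.

Definition artinian_module (R : pzRingType) (M : lmodType R) : Prop :=
  forall S : nat -> {pred M},
    (forall n, submod_closed (S n)) ->
    (forall n, {subset S n.+1 <= S n}) ->
    exists n, forall m, (n <= m)%N -> S m =i S n.

Definition semisimple_left_artinian (R : pzRingType) : Prop :=
  semisimple_module R^o /\ artinian_module R^o.

Definition ring_monomorphism (R S : pzRingType) (f : {rmorphism R -> S}) :
    Prop :=
  forall (T : pzRingType) (g h : {rmorphism T -> R}),
    f \o g =1 f \o h -> g =1 h.

Definition ring_epimorphism (R S : pzRingType) (f : {rmorphism R -> S}) :
    Prop :=
  forall (T : pzRingType) (g h : {rmorphism S -> T}),
    g \o f =1 h \o f -> g =1 h.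

Definition ring_bimorphism (R S : pzRingType) (f : {rmorphism R -> S}) :
    Prop :=
  ring_epimorphism f /\ ring_monomorphism f.

(* Main.v *)
(* The dual basis of the projective envelope E of L is finite: by essentiality
   and heredity a functional on E killing L is zero, so only the functionals
   that do not vanish at 1 matter.  Hence endomorphisms of E are determined by
   their value at 1, and E becomes a ring Q containing L by
   x * y := (the endomorphism sending 1 to y) x.  The dual basis reads
   1 = sum_t a_t t with a_t in L and Q a_t <= L.  This makes L -> Q an
   epimorphism and every L-linear map between Q-modules Q-linear, so Q inherits
   left heredity from L and left self-injectivity from E.

   A left hereditary left self-injective ring Q is semisimple (Osofsky).  It is
   von Neumann regular, so if 1 were not in the socle, one could split off
   infinitely many nonzero orthogonal idempotents c_(m,n).  The left ideal of
   the x such that, for some g, x c_(m,n) = 0 whenever n > g m, is projective;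
   its dual basis restricted to the c_(m,n) is countable, which a diagonal
   choice of g contradicts. *)
Require Import Defs.
From HB Require Import structures.
From mathcomp Require Import all_boot all_order all_algebra.
From mathcomp Require Import boolp classical_sets functions.

Set Implicit Arguments.
Unset Strict Implicit.
Unset Printing Implicit Defensive.

Import GRing.Theory.
Local Open Scope ring_scope.

Lemma linear_exists (R : pzRingType) (M N : lmodType R) (h : M -> N) :
  linear h -> exists g : {linear M -> N}, g =1 h.
Proof.
move=> hlin.
pose B := GRing.isLinear.Build R M N *:%R h hlin.
pose g : {linear M -> N} := HB.pack h B.
by exists g.
Qed.

(** * Submodules and projectivity *)

Section Submodules.
Variables (R : pzRingType) (M : lmodType R) (S : {pred M}).
Hypothesis clS : submod_closed S.

(* Carries the closure proof, so that the submodule structure can be inferred. *)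
Definition submod_pred of submod_closed S : {pred M} := S.

HB.instance Definition _ := GRing.isSubmodClosed.Build R M (submod_pred clS)
  (GRing.submod_closed_semi clS).

Record submod := Submod { submod_val :> M; _ : submod_val \in submod_pred clS }.

HB.instance Definition _ := [isSub for submod_val].
HB.instance Definition _ := [Choice of submod by <:].
HB.instance Definition _ := [SubChoice_isSubLmodule of submod by <:].

(* Locked so that simplification does not expose the projection. *)
Definition submod_incl : {linear submod -> M} :=
  locked (\val : {linear submod -> M}).

Local Lemma submod_inclE : submod_incl =1 submod_val.
Proof. by rewrite /submod_incl -lock. Qed.

Lemma submod_incl_inj : injective submod_incl.
Proof. by move=> x y; rewrite !submod_inclE; apply: val_inj. Qed.

Lemma submod_inclP (x : submod) : submod_incl x \in S.
Proof. by rewrite submod_inclE; apply: (valP x). Qed.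

Lemma submod_lift (x : M) : x \in S -> exists u : submod, submod_incl u = x.
Proof.
move=> xS; exists (Submod (xS : x \in submod_pred clS)).
by rewrite submod_inclE.
Qed.

Lemma submod_corestrict (N : lmodType R) (h : {linear N -> M}) :
  (forall x, h x \in S) ->
  exists g : {linear N -> submod}, forall x, submod_incl (g x) = h x.
Proof.
move=> hS; pose g0 x := Submod (hS x : h x \in submod_pred clS).
have [|g gE] := @linear_exists R N submod g0.
  by move=> a x y; apply: val_inj; rewrite /= !linearP.
by exists g => x; rewrite submod_inclE gE.
Qed.

End Submodules.

Definition lin_image (R : pzRingType) (M N : lmodType R) (h : {linear M -> N}) :
  {pred N} := [pred y | `[< exists x, h x = y >]].

Definition lin_kernel (R : pzRingType) (M N : lmodType R) (h : {linear M -> N}) :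
  {pred M} := [pred x | h x == 0].

Lemma lin_image_closed (R : pzRingType) (M N : lmodType R)
    (h : {linear M -> N}) : submod_closed (lin_image h).
Proof.
split=> [|a _ _ /asboolP[u <-] /asboolP[v <-]]; apply/asboolP.
  by exists 0; rewrite linear0.
by exists (a *: u + v); rewrite linearP.
Qed.

Lemma lin_kernel_closed (R : pzRingType) (M N : lmodType R)
    (h : {linear M -> N}) : submod_closed (lin_kernel h).
Proof.
split=> [|a u v]; rewrite !inE ?linear0 // => /eqP hu /eqP hv.
by rewrite linearP hu hv scaler0 addr0.
Qed.

Lemma projective_section (R : pzRingType) (M P : lmodType R)
    (h : {linear M -> P}) :
  projective P -> (forall y, exists x, h x = y) ->
  exists s : {linear P -> M}, cancel s h.
Proof. by move=> projP hsurj; apply: (projP _ _ h (idfun : {linear P -> P})). Qed.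

(** Over a left hereditary ring this splits every map from [M] to the regular module onto its image,
    which is a left ideal and hence projective. *)
Lemma image_section (R : pzRingType) (M N : lmodType R) (h : {linear M -> N}) :
  projective (submod (lin_image_closed h)) ->
  exists s : {linear submod (lin_image_closed h) -> M},
    forall u, h (s u) = submod_incl _ u.
Proof.
move=> projI.
have hI x : h x \in lin_image h by apply/asboolP; exists x.
have [g gE] := submod_corestrict (lin_image_closed h) hI.
have [|s sK] := projective_section (h := g) projI; last first.
  by exists s => u; rewrite -gE sK.
move=> y; have /asboolP[x hx] := submod_inclP y.
by exists x; apply: (@submod_incl_inj _ _ _ (lin_image_closed h)); rewrite gE.
Qed.

(** If [s] splits [h], then [x - s (h x)] lies in the kernel, so a lift on the kernel and a lift on
    [I] add up to a lift on [V]. *)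
Lemma projective_extension (R : pzRingType) (V I : lmodType R)
    (h : {linear V -> I}) :
  (forall y, exists x, h x = y) -> projective I ->
  projective (submod (lin_kernel_closed h)) -> projective V.
Proof.
move=> hsurj projI projK M N p f psurj.
have [s sK] := projective_section projI hsurj.
have [gK gKE] := projK M N p (f \o submod_incl (lin_kernel_closed h)) psurj.
have [gI gIE] := projI M N p (f \o s) psurj.
have [|r rE] := @submod_corestrict _ _ _ (lin_kernel_closed h) _
    (idfun \- (s \o h)).
  by move=> x; rewrite inE /= linearB /= sK subrr.
exists ((gK \o r) \+ (gI \o h)) => x /=.
have := gKE (r x); have := gIE (h x) => /= gIx gKx.
by rewrite linearD gKx gIx -linearD rE /= subrK.
Qed.

(** Induction on [F]: the image of the first coordinate is a left ideal, hence projective, and the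
    remaining coordinates separate the points of its kernel. *)
Lemma hereditary_coordinates (R : pzRingType) (T : eqType) (F : seq T)
    (V : lmodType R) (h : T -> {linear V -> R^o}) :
  left_hereditary R ->
  (forall x, (forall t, t \in F -> h t x = 0) -> x = 0) -> projective V.
Proof.
move=> hR; elim: F V h => [|t F IH] V h sep.
  move=> M N p f _; exists \0 => x /=.
  by rewrite (sep x) ?linear0.
have projI := hR _ _ (@submod_incl_inj _ _ _ (lin_image_closed (h t))).
have hI x : h t x \in lin_image (h t) by apply/asboolP; exists x.
have [g gE] := submod_corestrict (lin_image_closed (h t)) hI.
apply: (projective_extension (h := g)) => //.
  move=> y; have /asboolP[x hx] := submod_inclP y.
  by exists x; apply: (@submod_incl_inj _ _ _ (lin_image_closed (h t))); rewrite gE.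
pose j := submod_incl (lin_kernel_closed g).
apply: (IH _ (fun k => h k \o j)) => x x0.
apply: (@submod_incl_inj _ _ _ (lin_kernel_closed g)); rewrite linear0.
apply: sep => k; rewrite inE => /predU1P[->|kF]; last exact: (x0 k).
have /eqP gj : g (j x) == 0 := submod_inclP x.
by rewrite -gE gj linear0.
Qed.

(** * Dual bases of projective modules *)

Section DualBasis.
Variables (R : pzRingType) (P : lmodType R).

(** The free module on the set underlying [P], as functions of finite support. *)
Definition fin_supp : {pred P -> R^o} :=
  [pred f | `[< exists F : seq P, forall t, t \notin F -> f t = 0 >]].

Lemma fin_supp_closed : submod_closed fin_supp.
Proof.
split=> [|a f g /asboolP[F fF] /asboolP[G gG]]; apply/asboolP.
  by exists [::].
exists (F ++ G) => t; rewrite mem_cat negb_or => /andP[tF tG].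
by rewrite -[LHS]/(a *: f t + g t) fF // gG // scaler0 addr0.
Qed.

Local Notation free := (submod fin_supp_closed).

Lemma fin_supp_sum_sub (f : P -> R) (F G : seq P) :
  uniq F -> uniq G -> {subset F <= G} ->
  (forall t, t \notin F -> f t = 0) ->
  \sum_(t <- G) f t *: t = \sum_(t <- F) f t *: t.
Proof.
move=> uF uG sFG fF; rewrite (bigID (mem F)) /= [X in _ + X]big1 ?addr0.
  rewrite -big_filter; apply: perm_big; apply: uniq_perm => //.
    exact: filter_uniq.
  by move=> t; rewrite mem_filter; case: (boolP (t \in F)) => // /sFG.
by move=> t /fF ->; rewrite scale0r.
Qed.

Lemma fin_supp_sum (f : P -> R) (F G : seq P) :
  uniq F -> uniq G ->
  (forall t, t \notin F -> f t = 0) -> (forall t, t \notin G -> f t = 0) ->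
  \sum_(t <- F) f t *: t = \sum_(t <- G) f t *: t.
Proof.
move=> uF uG fF fG; pose H := undup (F ++ G).
have uH : uniq H := undup_uniq _.
rewrite -(@fin_supp_sum_sub f F H) // => [|t tF]; last first.
  by rewrite mem_undup mem_cat tF.
rewrite -(@fin_supp_sum_sub f G H) // => t tG.
by rewrite mem_undup mem_cat tG orbT.
Qed.

(** Any duplicate-free list containing the support is allowed, so that elements with different
    supports can be summed over a common list. *)
Lemma free_cover : exists e : {linear free -> P},
  forall (u : free) (F : seq P), uniq F ->
    (forall t, t \notin F -> submod_incl _ u t = 0) ->
    e u = \sum_(t <- F) (submod_incl _ u t : R) *: t.
Proof.
have suppP (u : free) : exists F : seq P,
    uniq F /\ forall t, t \notin F -> submod_incl _ u t = 0.
  have /asboolP[F uF] := submod_inclP u; exists (undup F).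
  by rewrite undup_uniq; split=> // t; rewrite mem_undup => /uF.
have [F /all_and2[uF F0]] := choice suppP.
pose e0 u : P := \sum_(t <- F u) (submod_incl _ u t : R) *: t.
have e0E u G : uniq G -> (forall t, t \notin G -> submod_incl _ u t = 0) ->
    e0 u = \sum_(t <- G) (submod_incl _ u t : R) *: t.
  by move=> uG G0; apply: (@fin_supp_sum (submod_incl _ u)) => //; apply: F0.
have [|e eE] := @linear_exists _ _ _ e0; last first.
  by exists e => u G uG G0; rewrite eE; apply: e0E.
move=> a u v; pose H := undup (F u ++ F v).
have uH : uniq H := undup_uniq _.
have Hu t : t \notin H -> submod_incl _ u t = 0.
  by rewrite mem_undup mem_cat negb_or => /andP[/F0].
have Hv t : t \notin H -> submod_incl _ v t = 0.
  by rewrite mem_undup mem_cat negb_or => /andP[_ /F0].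
rewrite (e0E u H) // (e0E v H) // (e0E _ H) // => [|t tH]; last first.
  by rewrite linearP -[LHS]/(a *: _ + _) Hu // Hv // scaler0 addr0.
rewrite scaler_sumr -big_split; apply: eq_bigr => t _ /=.
by rewrite linearP scalerA -scalerDl.
Qed.

(** The cover by the free module splits, and [s t] is the coordinate at [t] of the section. *)
Lemma dual_basis : projective P ->
  exists s : P -> {linear P -> R^o}, forall x, exists F : seq P,
    [/\ uniq F, forall t, t \notin F -> s t x = 0
      & x = \sum_(t <- F) (s t x : R) *: t].
Proof.
move=> projP; have [e eE] := free_cover.
have [|s sK] := projective_section (h := e) projP.
  move=> y; pose f : P -> R^o := fun t => if t == y then 1 else 0.
  have /(submod_lift fin_supp_closed)[u uE] : f \in fin_supp.
    by apply/asboolP; exists [:: y] => t; rewrite inE /f => /negPf->.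
  exists u; rewrite (eE u [:: y]) // => [|t]; rewrite uE.
    by rewrite big_seq1 /f eqxx scale1r.
  by rewrite inE /f => /negPf->.
have coord t : exists st : {linear P -> R^o},
    st =1 (fun x => submod_incl _ (s x) t).
  by apply: linear_exists => a x y; rewrite !linearP.
have [st stE] := choice coord; exists st => x.
have /asboolP[F F0] := submod_inclP (s x).
exists (undup F); rewrite undup_uniq; split=> // [t|].
  by rewrite mem_undup stE => /F0.
rewrite -[LHS]sK (eE _ (undup F)) ?undup_uniq //; last first.
  by move=> t; rewrite mem_undup => /F0.
by apply: eq_bigr => t _; rewrite stE.
Qed.

End DualBasis.

(** * Left ideals and socles *)

Lemma maximal_disjoint_submod (R : pzRingType) (M : lmodType R) (V : {pred M}) :
  exists T : {pred M}, [/\ submod_closed T,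
    forall x, x \in T -> x \in V -> x = 0
    & forall T' : {pred M}, submod_closed T' -> {subset T <= T'} ->
        (forall x, x \in T' -> x \in V -> x = 0) -> {subset T' <= T}].
Proof.
pose P (A : set M) := (forall a x y, A x -> A y -> A (a *: x + y)) /\
  (forall x, A x -> x \in V -> x = 0).
have [|A [[Alin AV] Amax]] := @Zorn_bigcup M P.
  move=> F FP Ftot; split=> [a x y [X FX Xx] [Y FY Yy]|x [X FX Xx]]; last first.
    by case: (FP X FX) => _; apply.
  case: (Ftot X Y FX FY) => sXY.
    by exists Y => //; case: (FP Y FY) => Ylin _; apply: Ylin => //; apply: sXY.
  by exists X => //; case: (FP X FX) => Xlin _; apply: Xlin => //; apply: sXY.
(* [P] does not ask for [0], because the union of the empty chain is empty. If [A] lacked [0], it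
   would be empty, and the set of [0] alone would contradict its maximality. *)
have A0 : A 0.
  apply: contrapT => nA0; apply: (Amax [set 0]%classic).
    split=> [x Ax|sub]; last exact/nA0/sub.
    by case: nA0; have := Alin (-1) x x Ax Ax; rewrite scaleN1r addNr.
  by split=> // a x y -> ->; rewrite /= scaler0 addr0.
exists (fun x => `[< A x >]); split.
- split=> [|a x y /asboolP Ax /asboolP Ay]; apply/asboolP => //.
  exact: Alin.
- by move=> x /asboolP; apply: AV.
move=> T' [T'0 T'lin] sAT' T'V x xT'; apply/asboolP; apply: contrapT => nAx.
apply: (Amax [set z | z \in T']%classic).
  by split=> [z Az|sub]; [apply/sAT'/asboolP | apply/nAx/sub].
by split=> [a y z|z]; [apply: T'lin | apply: T'V].
Qed.

Section RegularModule.
Variable Q : pzRingType.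

Lemma linear_regularE (h : {linear Q^o -> Q^o}) (x : Q) : h x = x * h 1.
Proof. by rewrite -[RHS]/(x *: h 1) -linearZ -[_ *: _]/(x * 1) mulr1. Qed.

Lemma mulr_linear (y : Q) : exists h : {linear Q^o -> Q^o}, h =1 (fun x : Q => x * y).
Proof.
apply: linear_exists => a x z.
by rewrite -[a *: x]/(a * x) mulrDl -mulrA.
Qed.

Lemma left_idealM (S : {pred Q^o}) (q x : Q) :
  submod_closed S -> x \in S -> q * x \in S.
Proof. by move=> [S0 Slin] xS; rewrite -[q * x]addr0; apply: Slin. Qed.

Lemma left_ideal_of_mul (S : {pred Q^o}) :
  0 \in S -> (forall x y, x \in S -> y \in S -> x + y \in S) ->
  (forall q x : Q, x \in S -> q * x \in S) -> submod_closed S.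
Proof. by move=> S0 SD SM; split=> // a x y xS yS; apply/SD => //; apply: SM. Qed.

End RegularModule.

Definition in_socle (R : pzRingType) (M : lmodType R) (x : M) : Prop :=
  exists (n : nat) (S : 'I_n -> {pred M}) (y : 'I_n -> M),
    (forall k, simple_submodule (S k) /\ y k \in S k) /\ x = \sum_(k < n) y k.

Section Socle.
Variables (R : pzRingType) (M : lmodType R).
Implicit Types (x y : M) (S T : {pred M}).

Lemma in_socle0 : in_socle (0 : M).
Proof.
exists 0%N, (fun _ _ => false), (fun=> 0); split; first by case.
by rewrite big_ord0.
Qed.

Lemma in_socle_simple S x : simple_submodule S -> x \in S -> in_socle x.
Proof.
move=> sS xS; exists 1%N, (fun=> S), (fun=> x); split=> //.
by rewrite big_ord1.
Qed.

Lemma in_socleD x y : in_socle x -> in_socle y -> in_socle (x + y).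
Proof.
move=> [m [S [u [Su ->]]]] [n [T [v [Tv ->]]]].
pose cat A (f : 'I_m -> A) (g : 'I_n -> A) (k : 'I_(m + n)) :=
  match fintype.split k with inl i => f i | inr j => g j end.
exists (m + n)%N, (cat _ S T), (cat _ u v); split.
  by move=> k; rewrite /cat; case: (fintype.split k).
rewrite big_split_ord /=; congr (_ + _); apply: eq_bigr => k _.
  by rewrite /cat (fintype.unsplitK (inl k)).
by rewrite /cat (fintype.unsplitK (inr k)).
Qed.

Lemma in_socleZ (a : R) x : in_socle x -> in_socle (a *: x).
Proof.
move=> [n [S [y [Sy ->]]]]; exists n, S, (fun k => a *: y k); split.
  move=> k; have [sS yS] := Sy k; split=> //.
  by case: sS => -[S0 Slin] _ _; rewrite -[_ *: _]addr0; apply: Slin.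
by rewrite scaler_sumr.
Qed.

Lemma simple_submodule_full S T x : simple_submodule S -> submod_closed T ->
  x \in S -> x \in T -> x != 0 -> {subset S <= T}.
Proof.
move=> [[S0 Slin] _ Smin] [T0 Tlin] xS xT x0 z zS.
pose U : {pred M} := [pred w | (w \in S) && (w \in T)].
have [||U0|US] := Smin U.
- split=> [|a u v /andP[uS uT] /andP[vS vT]]; apply/andP => //.
  by split; [apply: Slin | apply: Tlin].
- by move=> w /andP[].
- by have := U0 x; rewrite !inE xS xT (negPf x0).
by have := US z; rewrite zS => /andP[].
Qed.

Lemma artinian_of_simple_sum (n : nat) (S : nat -> {pred M}) :
  (forall k, simple_submodule (S k)) ->
  (forall x, exists y : nat -> M, (forall k, y k \in S k) /\ x = \sum_(k < n) y k) ->
  artinian_module M.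
Proof.
move=> sS gen T clT decT.
have dec m m' : (m <= m')%N -> {subset T m' <= T m}.
  elim: m' => [|m' IH]; first by rewrite leqn0 => /eqP->.
  rewrite leq_eqVlt => /predU1P[-> //|/IH sub] x /decT; exact: sub.
pose below j x := exists y : nat -> M,
  (forall k, y k \in S k) /\ x = \sum_(k < j) y k.
have belowB j x y : below j x -> below j y -> below j (x - y).
  move=> [u [uS ->]] [v [vS ->]]; exists (fun k => u k - v k).
  split=> [k|]; last by rewrite sumrB.
  have [[S0 Slin] _ _] := sS k.
  by rewrite addrC -scaleN1r; apply: Slin.
(* Below the first [j] simple summands the chain is eventually constant: the
   chain either stops meeting the [j]-th layer or always covers it. *)
have stable j : exists m0, forall m x, (m0 <= m)%N -> below j x ->
    x \in T m0 -> x \in T m.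
  elim: j => [|j [m0 IH]].
    exists 0%N => m x _ [y [_ ->]] _; rewrite big_ord0; by case: (clT m).
  have [[m1 [m01 Tm1]]|nT] := pselect (exists m1, (m0 <= m1)%N /\
      forall x, below j.+1 x -> x \in T m1 -> below j x).
    exists m1 => m x m1m xj xT; apply: IH; first exact: leq_trans m1m.
      exact: Tm1.
    exact: dec xT.
  exists m0 => m x m0m [y [yS xE]] xT.
  have [z [[w [wS zE]] zT zj]] : exists z, [/\ below j.+1 z, z \in T m & ~ below j z].
    apply: contrapT => nz; apply: nT; exists m; split=> // z zj zT.
    by apply: contrapT => nzj; apply: nz; exists z.
  rewrite big_ord_recr /= in xE; rewrite big_ord_recr /= in zE.
  have wj0 : w j != 0.
    by apply/eqP => w0; apply: zj; exists w; rewrite zE w0 addr0.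
  (* As [S j] is simple, [y j] is a multiple of [w j]; subtracting the same multiple of [z] from [x]
     removes the [j]-th summand. *)
  pose U : {pred M} := fun v => `[< exists a : R, v = a *: w j >].
  have clU : submod_closed U.
    split=> [|a _ _ /asboolP[b ->] /asboolP[c ->]]; apply/asboolP.
      by exists 0; rewrite scale0r.
    by exists (a * b + c); rewrite scalerDl scalerA.
  have /(_ (y j) (yS j))/asboolP[a yE] : {subset S j <= U}.
    apply: (simple_submodule_full (sS j) clU (wS j)) => //.
    by apply/asboolP; exists 1; rewrite scale1r.
  have azT : a *: z \in T m.
    by have [T0 Tlin] := clT m; rewrite -[_ *: _]addr0; apply: Tlin.
  have xzT : x - a *: z \in T m.
    apply: (IH m) => //; last first.
      have [T0 Tlin] := clT m0.
      by rewrite addrC -scaleN1r; apply: Tlin => //; apply: dec azT.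
    exists (fun k => y k - a *: w k); split=> [k|].
      have [[S0 Slin] _ _] := sS k.
      by rewrite -scaleNr addrC; apply: Slin.
    by rewrite xE zE yE scalerDr scaler_sumr sumrB opprD addrACA subrr addr0.
  have [T0 Tlin] := clT m.
  by have := Tlin 1 _ _ xzT azT; rewrite scale1r subrK.
have [m0 m0P] := stable n; exists m0 => m m0m x.
apply/idP/idP; first exact: dec.
by apply: m0P => //; apply: gen.
Qed.

End Socle.

(** * Left hereditary left self-injective rings *)

Section Osofsky.
Variable Q : pzRingType.
Hypothesis (hQ : left_hereditary Q) (iQ : injective_module Q^o).

Lemma extend_to_mulr (S : {pred Q^o}) (clS : submod_closed S)
    (h : {linear submod clS -> Q^o}) :
  exists y : Q, forall x, h x = submod_incl clS x * y.
Proof.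
have [g gE] := iQ h (@submod_incl_inj _ _ _ clS).
by exists (g 1) => x; rewrite -gE /= linear_regularE.
Qed.

(** The left ideal [Q x] is projective, so right multiplication by [x] splits over it; by
    self-injectivity the section is right multiplication by some [y]. *)
Lemma von_neumann_regular (x : Q) : exists y, x * y * x = x.
Proof.
have [h hE] := mulr_linear x.
have [s sK] := image_section (h := h) (hQ (@submod_incl_inj _ _ _ _)).
have [y yE] := extend_to_mulr s.
have [|u uE] := @submod_lift _ _ _ (lin_image_closed h) x.
  by apply/asboolP; exists 1; rewrite hE mul1r.
by exists y; have := sK u; rewrite hE yE uE.
Qed.

(** The sum of [V] and [W] is direct; its projection onto [V] extends to [Q^o], and [u] is the value
    of the extension at [1]. *)
Lemma separating_element (V W : {pred Q^o}) :
  submod_closed V -> submod_closed W -> (forall x, x \in W -> x \in V -> x = 0) ->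
  exists u : Q, (forall v : Q, v \in V -> v * u = v) /\
    (forall w : Q, w \in W -> w * u = 0).
Proof.
move=> clV clW VW0; pose M := (submod clV * submod clW)%type.
have [|i iE] := @linear_exists _ M Q^o
    (fun x => submod_incl clV x.1 + submod_incl clW x.2).
  by move=> a x y /=; rewrite !linearP scalerDr addrACA.
have [|f fE] := @linear_exists _ M Q^o (fun x => submod_incl clV x.1).
  by move=> a x y /=; rewrite !linearP.
have inj_i : injective i.
  apply: raddf_inj => -[v w] ivw.
  have /esym/eqP := iE (v, w); rewrite [i _]ivw /= addr_eq0 => /eqP vw.
  have v0 : submod_incl clV v = 0.
    apply: VW0; last exact: submod_inclP.
    rewrite vw -mulN1r; apply: left_idealM => //; exact: submod_inclP.
  move: vw; rewrite v0 => /esym/eqP; rewrite oppr_eq0 => /eqP w0.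
  congr pair; apply: submod_incl_inj; [rewrite v0|rewrite w0]; by rewrite linear0.
have [g gE] := iQ f inj_i; exists (g 1); split=> [v vV|w wW].
  have [x xE] := submod_lift clV vV.
  have := gE (x, 0); rewrite /= iE fE /= linear0 addr0 linear_regularE.
  by rewrite xE.
have [x xE] := submod_lift clW wW.
have := gE (0, x); rewrite /= iE fE /= linear0 add0r linear_regularE.
by rewrite xE.
Qed.

(** This is the Baer property: the right annihilator of [V] is [(1 - u) Q]. The element [u]
    separates [V] from a maximal left ideal [T] meeting [V] trivially. *)
Lemma baer_element (V : {pred Q^o}) : submod_closed V ->
  exists u : Q, (forall v : Q, v \in V -> v * u = v) /\
    (forall z, (forall v : Q, v \in V -> v * z = 0) -> u * z = 0).
Proof.
move=> clV; have [T [clT TV0 Tmax]] := maximal_disjoint_submod V.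
have [u [uV uT]] := separating_element clV clT TV0.
exists u; split=> // z Vz; have [w yE] := von_neumann_regular (u * z).
set y := u * z in yE *.
(* If [y] were nonzero, [Q * (y * w)] could be added to [T], since [V + T]
   annihilates [y]. *)
have Vy v : v \in V -> v * y = 0 by move=> vV; rewrite mulrA uV // Vz.
have Ty t : t \in T -> t * y = 0 by move=> tT; rewrite mulrA uT // mul0r.
pose T' : {pred Q^o} := [pred x | `[< exists t q : Q, t \in T /\ x = t + q * (y * w) >]].
suff /Ty : y * w \in T by rewrite yE.
apply: (Tmax T').
- apply: left_ideal_of_mul.
  + by apply/asboolP; exists 0, 0; rewrite mul0r addr0; case: clT.
  + move=> _ _ /asboolP[t [q [tT ->]]] /asboolP[t' [q' [t'T ->]]].
    apply/asboolP; exists (t + t'), (q + q'); rewrite mulrDl addrACA; split=> //.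
    by case: clT => _ /(_ 1 t t' tT t'T); rewrite scale1r.
  move=> q _ /asboolP[t [q' [tT ->]]]; apply/asboolP; exists (q * t), (q * q').
  by rewrite mulrDr mulrA; split=> //; apply: left_idealM.
- by move=> t tT; apply/asboolP; exists t, 0; rewrite mul0r addr0.
- move=> x /asboolP[t [q [tT xE]]] xV.
  have := Vy x xV; rewrite xE mulrDl Ty // add0r -mulrA yE => qy0.
  have xt : x = t by rewrite xE mulrA qy0 mul0r addr0.
  by rewrite -xE; apply: TV0; rewrite ?xV ?xt.
by apply/asboolP; exists 0, 1; rewrite mul1r add0r; case: clT.
Qed.

Lemma no_orthogonal_array (c : nat -> nat -> Q) :
  (forall m n, c m n * c m n = c m n) ->
  (forall m n m' n', (m, n) <> (m', n') -> c m n * c m' n' = 0) ->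
  exists m n, c m n = 0.
Proof.
move=> cid corth; apply: contrapT => cN0.
pose J : {pred Q^o} := [pred x |
  `[< exists f : nat -> nat, forall m n, (f m < n)%N -> (x : Q) * c m n = 0 >]].
have clJ : submod_closed J.
  apply: left_ideal_of_mul.
  - by apply/asboolP; exists (fun=> 0%N) => m n _; rewrite mul0r.
  - move=> x y /asboolP[f fx] /asboolP[g gy]; apply/asboolP.
    exists (fun m => maxn (f m) (g m)) => m n; rewrite gtn_max => /andP[fn gn].
    by rewrite mulrDl fx // gy // addr0.
  move=> q x /asboolP[f fx]; apply/asboolP; exists f => m n fn.
  by rewrite -mulrA fx // mulr0.
have [s sP] := dual_basis (hQ (@submod_incl_inj _ _ _ clJ)).
pose j := submod_incl clJ.
have [y yE] := choice (fun t => extend_to_mulr (s t)).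
have /choice[f fP] t : exists f : nat -> nat,
    forall m n, (f m < n)%N -> (j t : Q) * c m n = 0.
  by have /asboolP := submod_inclP t.
have /choice[C CE] (p : nat * nat) : exists C, j C = c p.1 p.2.
  case: p => m n; apply: submod_lift.
  apply/asboolP; exists (fun=> n) => m' n' nn'.
  by apply: corth => -[_ E]; rewrite E ltnn in nn'.
(* Each [c m n] lies in [J], so only finitely many coordinates, listed by [F (m, n)], are nonzero on
   it. *)
have /choice[F FP] (p : nat * nat) : exists F : seq (submod clJ),
    forall t, t \notin F -> c p.1 p.2 * y t = 0.
  have [F [_ F0 _]] := sP (C p).
  by exists F => t /F0; rewrite yE -/j CE.
pose L k := flatten [seq F p | p <- allpairs pair (iota 0 k) (iota 0 k)].
have LP k m n t : t \in F (m, n) -> (m < k)%N -> (n < k)%N -> t \in L k.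
  move=> tF mk nk; apply/flatten_mapP; exists (m, n) => //.
  by apply/allpairsP; exists (m, n); rewrite /= !mem_iota.
(* Diagonal choice: [j t * c k (g k) = 0] for all [t] in [L k]. *)
pose g k := (\max_(t <- L k) f t k).+1.
pose V : {pred Q^o} :=
  [pred x | `[< forall m n, (g m < n)%N -> (x : Q) * c m n = 0 >]].
have clV : submod_closed V.
  apply: left_ideal_of_mul.
  - by apply/asboolP => m n _; rewrite mul0r.
  - move=> x z /asboolP xV /asboolP zV; apply/asboolP => m n gn.
    by rewrite mulrDl xV // zV // addr0.
  by move=> q x /asboolP xV; apply/asboolP => m n gn; rewrite -mulrA xV // mulr0.
(* [uz] puts [u] in [J], with [g] as witness, so [u] has a finite expansion; [uV] makes [u] a right
   identity on [V]. *)
have [u [uV uz]] := baer_element clV.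
have [U UE] : exists U, j U = u.
  apply: submod_lift; apply/asboolP; exists g => m n gn; apply: uz => v.
  by move=> /asboolP; apply.
have [G [_ _ Usum]] := sP U.
have {Usum} uE : u = \sum_(t <- G) u * y t * (j t : Q).
  rewrite -{1}UE {1}Usum linear_sum; apply: eq_bigr => t _.
  by rewrite linearZ /= yE -/j UE.
(* [k] is so large that [L k] contains every [t] of [G] that occurs in some [F p]. *)
have [k kP] : exists k, forall t, t \in G ->
    forall p, t \in F p -> exists q, [/\ t \in F q, (q.1 < k)%N & (q.2 < k)%N].
  elim: G {uE} => [|t G [k kP]]; first by exists 0%N.
  have [[[m n] tF]|nF] := pselect (exists p, t \in F p); last first.
    exists k => t'; rewrite inE => /predU1P[-> p tF|]; last exact: kP.
    by case: nF; exists p.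
  exists (maxn k (maxn m n).+1) => t'; rewrite inE => /predU1P[-> _ _|t'G p].
    by exists (m, n); rewrite /= !leq_max !ltnS ?leq_maxl ?leq_maxr !orbT.
  by case/kP=> // q [tq q1 q2]; exists q; rewrite !leq_max q1 q2.
pose ck := c k (g k).
have ckV : ck \in V.
  apply/asboolP => m n gn; apply: corth => -[E1 E2]; subst m n.
  by rewrite ltnn in gn.
(* Expand [ck = ck * u * ck] by [uE]. The term of [t] vanishes through [j t * ck = 0] if [t] is in
   [F (k, g k)], hence in [L k], and through [ck * y t = 0] otherwise. *)
apply: cN0; exists k, (g k); rewrite -/ck -[LHS](cid k (g k)) -/ck -{1}(uV ck ckV) uE.
rewrite mulr_sumr mulr_suml big_seq big1 // => t tG.
rewrite !mulrA (uV ck ckV); case: (boolP (t \in F (k, g k))) => [tF|/FP /= ->].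
  rewrite -mulrA fP ?mulr0 // /g ltnS.
  have [// | [m n] [/LP tmn mk nk]] := kP t tG (k, g k).
  exact: (leq_bigmax_seq (F := fun t => f t k) t (tmn _ mk nk)).
by rewrite !mul0r.
Qed.

(** Since [e] is outside the socle, [Q e] is not simple, and regularity yields an idempotent in a
    proper nonzero left ideal of it. Of the two resulting summands of [e], at least one is outside
    the socle. *)
Lemma idempotent_split (e : Q) : e * e = e -> ~ in_socle (e : Q^o) ->
  exists p : Q, [/\ p * p = p, e * p = p, p * e = p, p <> e
    & ~ in_socle (p : Q^o)].
Proof.
move=> ee nsoc.
pose S : {pred Q^o} := fun x => (x : Q) * e == x.
have clS : submod_closed S.
  apply: left_ideal_of_mul => [|x y /eqP xe /eqP ye|q x /eqP xe]; apply/eqP.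
  - by rewrite mul0r.
  - by rewrite mulrDl xe ye.
  by rewrite -mulrA xe.
have eS : e \in S by apply/eqP.
have e0 : e != 0 by apply/eqP => e0; apply: nsoc; rewrite e0; apply: in_socle0.
have [T [clT TS [z zT z0] eT]] : exists T : {pred Q^o}, [/\ submod_closed T,
    {subset T <= S}, exists2 z, z \in T & z != 0 & e \notin T].
  apply: contrapT => nT; apply: nsoc; apply: (@in_socle_simple _ _ S) => //.
  split=> //; first by exists e.
  move=> T clT TS; have [eT|eT] := boolP (e \in T).
    right=> x; apply/idP/idP; first exact: TS.
    by move=> /eqP xE; rewrite -xE; apply: left_idealM.
  left=> x; rewrite !inE; apply/idP/eqP => [xT|->]; last by case: clT.
  apply/eqP; apply: contrapT => /negP x0; apply: nT; exists T; split=> //.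
  by exists x.
have [y zyz] := von_neumann_regular z.
have pT : y * z \in T by apply: left_idealM.
have /eqP pe : (y * z) * e == y * z by apply: TS.
have pp : y * z * (y * z) = y * z by rewrite -mulrA (mulrA z) zyz.
have /eqP ze : (z : Q) * e == z by apply: TS.
(* The factor [e] on the left gives [e * p = p] and keeps [p] in [T]; [p] is nonzero because
   [z * p = z]. *)
pose p := e * (y * z).
have pI : p * p = p by rewrite /p mulrA -(mulrA e) pe -mulrA pp.
have ep : e * p = p by rewrite /p mulrA ee.
have pE : p * e = p by rewrite /p -mulrA pe.
have pTe : p \in T by apply: left_idealM.
have [psoc|] := pselect (in_socle (p : Q^o)); last first.
  by exists p; split=> // pe'; rewrite -pe' pTe in eT.
exists (e - p); split.
- by rewrite mulrBl !mulrBr ee ep pE pI subrr subr0.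
- by rewrite mulrBr ee ep.
- by rewrite mulrBl ee pE.
- rewrite -[RHS]subr0 => /addrI/oppr_inj p0.
  case/eqP: z0; rewrite -zyz -mulrA -{1}ze -mulrA -/p p0 mulr0 //.
by move=> qsoc; apply: nsoc; rewrite -(subrK p e); apply: in_socleD.
Qed.

(** Otherwise repeated splitting gives a strictly decreasing chain [b] of idempotents. Its
    differences [d] are nonzero and orthogonal, and a coding of pairs arranges them in a forbidden
    array. *)
Lemma one_in_socle : in_socle (1 : Q^o).
Proof.
apply: contrapT => nsoc.
pose bad := {e : Q | e * e = e /\ ~ in_socle (e : Q^o)}.
have /choice[next nextP] (b : bad) : exists b' : bad,
    [/\ sval b * sval b' = sval b', sval b' * sval b = sval b' & sval b' <> sval b].
  case: b => e [ee ne] /=.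
  have [p [pp ep pe pne np]] := idempotent_split ee ne.
  by exists (exist _ p (conj pp np)).
pose b k := sval (iter k next (exist _ 1 (conj (mulr1 1) nsoc) : bad)).
have bb k : b k * b k = b k by rewrite /b; case: (iter _ _ _) => ? [].
have bmul m k : b m * b (m + k)%N = b (m + k)%N /\ b (m + k)%N * b m = b (m + k)%N.
  elim: k => [|k [IH1 IH2]]; first by rewrite addn0.
  have [n1 n2 _] := nextP (iter (m + k) next (exist _ 1 (conj (mulr1 1) nsoc))).
  rewrite -[sval (next _)]/(b (m + k).+1) -[sval (iter _ _ _)]/(b (m + k)%N) in n1 n2.
  by rewrite addnS; split; [rewrite -n1 mulrA IH1 | rewrite -n2 -mulrA IH2].
have bl m k : (m <= k)%N -> b m * b k = b k by move/subnKC <-; case: (bmul m (k - m)%N).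
have br m k : (m <= k)%N -> b k * b m = b k by move/subnKC <-; case: (bmul m (k - m)%N).
pose d k := b k - b k.+1.
have dd k : d k * d k = d k.
  by rewrite /d mulrBl !mulrBr !bb bl // br // subrr subr0.
have dl m k : (m < k)%N -> d m * d k = 0.
  move=> mk; rewrite /d mulrBl !mulrBr !bl ?subrr //; do ?exact: ltnW.
  exact: ltnW (ltnW _).
have dr m k : (m < k)%N -> d k * d m = 0.
  move=> mk; rewrite /d mulrBl !mulrBr !br ?subrr //; do ?exact: ltnW.
  exact: ltnW (ltnW _).
have [||m [n /eqP]] := @no_orthogonal_array (fun m n => d (pickle (m, n))).
- by move=> m n; apply: dd.
- move=> m n m' n' ne.
  have /eqP : pickle (m, n) <> pickle (m', n') by move/(pcan_inj pickleK).
  by rewrite neq_ltn => /orP[/dl|/dr].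
rewrite subr_eq0 eq_sym => /eqP.
by case: (nextP (iter (pickle (m, n)) next (exist _ 1 (conj (mulr1 1) nsoc)))).
Qed.

Theorem hereditary_selfinjective_semisimple : semisimple_left_artinian Q.
Proof.
have soc1 := one_in_socle; split=> [x|].
  by have := in_socleZ x soc1; rewrite -[_ *: _]/(x * 1) mulr1.
have [n [S [y [Sy oneE]]]] := soc1.
(* For [n = 0] the ring is zero; otherwise ['I_n] has an element to serve as default when the
   summands are reindexed by [nat]. *)
have [n0|n0] := posnP n.
  have Q0 (x : Q) : x = 0.
    rewrite -[x]mulr1 oneE big1 ?mulr0 // => k.
    by have := ltn_ord k; rewrite {2}n0.
  move=> T clT _; exists 0%N => m _ x.
  by rewrite (Q0 x); case: (clT m) => -> _; case: (clT 0%N) => -> _.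
pose o k : 'I_n := insubd (Ordinal n0) k.
have oE (k : 'I_n) : o k = k by rewrite /o valKd.
apply: (@artinian_of_simple_sum _ _ n (S \o o)) => [k|x].
  by case: (Sy (o k)).
exists (fun k => (x : Q) * y (o k)); split=> [k|].
  have [[clS _ _] yS] := Sy (o k); exact: left_idealM.
under eq_bigr do rewrite oE.
by rewrite -mulr_sumr -oneE mulr1.
Qed.

End Osofsky.

(** * Restriction of scalars *)

(** An alias of the carrier, which can bear the [R]-action through [f] beside the [S]-action. *)
Definition restr (R S : pzRingType) (f : {rmorphism R -> S}) (M : lmodType S) :
  Type := M.

Section RestrictionOfScalars.
Variables (R S : pzRingType) (f : {rmorphism R -> S}).

HB.instance Definition _ (M : lmodType S) := GRing.Zmodule.on (restr f M).

Definition restr_scale (M : lmodType S) (a : R) (x : restr f M) : restr f M :=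
  f a *: (x : M).

Lemma restr_scaleA (M : lmodType S) (a b : R) (x : restr f M) :
  restr_scale a (restr_scale b x) = restr_scale (a * b) x.
Proof. by rewrite /restr_scale rmorphM scalerA. Qed.

Lemma restr_scale1 (M : lmodType S) : left_id 1 (@restr_scale M).
Proof. by move=> x; rewrite /restr_scale rmorph1 scale1r. Qed.

Lemma restr_scaleDr (M : lmodType S) : right_distributive (@restr_scale M) +%R.
Proof. by move=> a x y; rewrite /restr_scale scalerDr. Qed.

Lemma restr_scaleDl (M : lmodType S) (x : restr f M) :
  {morph (@restr_scale M)^~ x : a b / a + b}.
Proof. by move=> a b; rewrite /restr_scale rmorphD scalerDl. Qed.

HB.instance Definition _ (M : lmodType S) :=
  GRing.Zmodule_isLmodule.Build R (restr f M)
    (@restr_scaleA M) (@restr_scale1 M) (@restr_scaleDr M) (@restr_scaleDl M).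

Lemma restr_linear (M N : lmodType S) (g : {linear M -> N}) :
  exists h : {linear restr f M -> restr f N}, h =1 g.
Proof. by apply: linear_exists => a x y; rewrite -[a *: x]/(f a *: (x : M)) linearP. Qed.

End RestrictionOfScalars.

(** * Ring extensions with a finite trace decomposition of [1] *)

Section TraceGenerated.
Variables (R S : pzRingType) (f : {rmorphism R -> S}).
Variables (F : seq S) (a : S -> R).
Hypothesis trace : forall t q, exists b, q * f (a t) = f b.
Hypothesis unit_sum : 1 = \sum_(t <- F) f (a t) * t.

Lemma trace_decomp (q : S) : q = \sum_(t <- F) q * f (a t) * t.
Proof.
by rewrite -[LHS]mulr1 unit_sum mulr_sumr; apply: eq_bigr => t _; rewrite mulrA.
Qed.

(** In [g q = \sum_t g (q * f (a t)) * h t] the arguments of [g] lie in the image of [f], where [g]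
    and [h] agree. *)
Lemma trace_epimorphism : ring_epimorphism f.
Proof.
move=> T g h gh q; have {}gh b : g (f b) = h (f b) := gh b.
rewrite -[LHS]mulr1 -(rmorph1 h).
rewrite unit_sum rmorph_sum mulr_sumr [in RHS](trace_decomp q) rmorph_sum.
apply: eq_bigr => t _; rewrite rmorphM -gh mulrA -rmorphM.
by have [b ->] := trace t q; rewrite gh rmorphM.
Qed.

(** Each [q * f (a t)] is in the image of [f], so it passes through [g]. Comparing the resulting
    formula for [g (q *: x)] with its case [q = 1] gives [S]-linearity. *)
Lemma restr_linear_inv (M N : lmodType S) (g : {linear restr f M -> restr f N}) :
  exists h : {linear M -> N}, h =1 g.
Proof.
have gf b (m : M) : g (f b *: m) = f b *: (g m : N) by exact: (linearZ_LR g b m).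
have gE (q : S) (x : M) :
    g (q *: x) = \sum_(t <- F) q *: (f (a t) *: (g (t *: x) : N)) :> N.
  rewrite [X in X *: x]trace_decomp scaler_suml.
  rewrite [LHS](raddf_sum (g : {additive M -> N})); apply: eq_bigr => t _.
  by rewrite !scalerA; have [b ->] := trace t q; rewrite -gf scalerA.
apply: linear_exists => q x y; rewrite linearD; congr (_ + _).
by rewrite gE -[in RHS](scale1r x) gE scaler_sumr; under [RHS]eq_bigr do rewrite scale1r.
Qed.

Lemma trace_self_injective :
  injective_module (restr f S^o) -> injective_module S^o.
Proof.
move=> iS M N i h inj_i.
have [i' i'E] := restr_linear f i; have [h' h'E] := restr_linear f h.
have [|g gE] := iS _ _ i' h'; first by move=> x y; rewrite !i'E; apply: inj_i.
have [g' g'E] := restr_linear_inv g; exists g' => x.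
by rewrite /= g'E -i'E -h'E -gE.
Qed.

(** The maps sending [m] to [j m * f (a t)] take values in the copy of [R] and jointly separate
    points, so [M] is projective over [R]; lifts over [R] are [S]-linear. *)
Lemma trace_hereditary : injective f -> left_hereditary R -> left_hereditary S.
Proof.
move=> inj_f hR M j inj_j.
have /choice[h hE] (t : S) : exists h : {linear restr f M -> R^o},
    forall m, (j m : S) * f (a t) = f (h m).
  have /choice[h0 h0E] (m : M) := trace t (j m).
  have [|h hE] := @linear_exists _ (restr f M) R^o h0.
    move=> b x y; apply: inj_f; rewrite -h0E rmorphD rmorphM -!h0E.
    by rewrite -[b *: x]/(f b *: (x : M)) linearP mulrDl -mulrA.
  by exists h => m; rewrite hE.
have projM : projective (restr f M).
  apply: (hereditary_coordinates (F := F) (h := h)) => // m m0.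
  apply: inj_j; rewrite [LHS]trace_decomp big_seq big1 ?linear0 // => t tF.
  by rewrite hE m0 // rmorph0 mul0r.
move=> A B p k psurj.
have [p' p'E] := restr_linear f p; have [k' k'E] := restr_linear f k.
have [|g gE] := projM _ _ p' k'.
  by move=> y; have [x <-] := psurj y; exists x.
have [g' g'E] := restr_linear_inv g; exists g' => x.
by rewrite /= g'E -p'E -k'E -gE.
Qed.

End TraceGenerated.

(** * The ring structure on the injective envelope *)

Section Envelope.
Variables (R : pzRingType) (E : lmodType R) (i : {linear R^o -> E}).
Hypothesis hR : left_hereditary R.
Hypotheses (injE : injective_module E) (essi : essential_embedding i).

(** The image of [h] is projective, so it embeds in [E] as a complement of the kernel. If nonzero,
    it would meet the image of [i], which lies in the kernel. *)
Lemma envelope_functional0 (h : {linear E -> R^o}) :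
  (forall r, h (i r) = 0) -> forall x, h x = 0.
Proof.
move=> hi x; have [_ ess] := essi.
have [s sK] := image_section (h := h) (hR (@submod_incl_inj _ _ _ _)).
have [//|u uE] := @submod_lift _ _ _ (lin_image_closed h) (h x).
  by apply/asboolP; exists x.
apply/eqP; apply: contrapT => /negP hx0.
have [||r /asboolP[v vE] r0] := ess (lin_image s).
- exact: lin_image_closed.
- exists (s u); first by apply/asboolP; exists u.
  by apply: contra hx0 => /eqP su0; rewrite -uE -sK su0 linear0.
case/eqP: r0; rewrite -vE; suff -> : v = 0 by rewrite linear0.
by apply: submod_incl_inj; rewrite -sK vE hi linear0.
Qed.

Hypothesis projE : projective E.

(** A coordinate vanishing at [i 1] vanishes on the image of [i], hence everywhere, so the finite
    list for [i 1] serves all [x]. *)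
Lemma envelope_finite_dual_basis :
  exists (F : seq E) (s : E -> {linear E -> R^o}),
    forall x, x = \sum_(t <- F) (s t x : R) *: t.
Proof.
have [s sP] := dual_basis projE.
have [F [uF F0 _]] := sP (i 1); exists F, s => x.
have s0 t y : t \notin F -> s t y = 0.
  move=> tF; apply: envelope_functional0 => r.
  by rewrite -[r](mulr1 (r : R)) -[r * 1]/(r *: (1 : R^o)) !linearZ /= F0 // scaler0.
have [G [uG G0 {1}->]] := sP x.
by apply: (@fin_supp_sum _ _ (s^~ x)) => // t /s0.
Qed.

Lemma envelope_endo0 (g : {linear E -> E}) : g (i 1) = 0 -> forall x, g x = 0.
Proof.
move=> g1 x; have [F [s sP]] := envelope_finite_dual_basis.
rewrite (sP (g x)) big1 // => t _.
rewrite -[s t (g x)]/((s t \o g) x) envelope_functional0 ?scale0r // => r.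
rewrite -[r](mulr1 (r : R)) -[r * 1]/(r *: (1 : R^o)) /=.
by rewrite !linearZ /= g1 linear0 scaler0.
Qed.

Lemma envelope_endo (y : E) : exists g : {linear E -> E}, g (i 1) = y.
Proof.
have [|f fE] := @linear_exists _ R^o E (fun r => (r : R) *: y).
  by move=> r u v; rewrite scalerDl scalerA.
have [g gE] := injE f (proj1 essi); exists g.
by have := gE 1; rewrite /= fE scale1r.
Qed.

Lemma envelope_ring : exists (S : pzRingType) (f : {rmorphism R -> S})
    (F : seq S) (a : S -> R),
  [/\ injective f, injective_module (restr f S^o),
      forall t q, exists b, q * f (a t) = f b
    & 1 = \sum_(t <- F) f (a t) * t].
Proof.
have [r rE] := choice envelope_endo.
have endo_eq (g h : {linear E -> E}) : g (i 1) = h (i 1) -> g =1 h.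
  move=> gh x; apply/eqP; rewrite -subr_eq0; apply/eqP.
  by apply: (@envelope_endo0 (g \- h)); rewrite /= gh subrr.
pose mul (x y : E) : E := r y x.
have mulA : associative mul.
  move=> x y z; rewrite /mul.
  by apply: (endo_eq (r (r z y)) (r z \o r y)); rewrite /= !rE.
have mul1 : left_id (i 1) mul by move=> x; rewrite /mul rE.
have mulx1 : right_id (i 1) mul.
  by move=> x; rewrite /mul; apply: (endo_eq (r (i 1)) idfun); rewrite rE.
have mulDl : left_distributive mul +%R by move=> x y z; rewrite /mul linearD.
have mulDr : right_distributive mul +%R.
  move=> x y z; rewrite /mul.
  by apply: (endo_eq (r (y + z)) (r y \+ r z)); rewrite /= !rE.
pose B := GRing.Zmodule_isPzRing.Build E mulA mul1 mulx1 mulDl mulDr.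
pose S : pzRingType := HB.pack E B.
have iM (b : R) (x : E) : mul (i b) x = b *: x.
  by rewrite /mul -{1}[b](mulr1 (b : R)) -[b * 1]/(b *: (1 : R^o)) !linearZ /= rE.
have imul : GRing.monoid_morphism (i : R -> S).
  split=> // b c; rewrite -[_ * _ in RHS]/(mul (i b) (i c)) iM.
  by rewrite -[b * c]/(b *: (c : R^o)) linearZ.
pose Bi := GRing.isZmodMorphism.Build R S i (raddfB i).
pose Bm := GRing.isMonoidMorphism.Build R S i imul.
pose f : {rmorphism R -> S} := HB.pack (i : R -> S) Bi Bm.
have [F [s sP]] := envelope_finite_dual_basis.
exists S, f, F, (fun t => s t (i 1)); split.
- exact: (proj1 essi).
(* By [iM], [restr f S^o] and [E] carry the same action, so maps are only repackaged between
   them. *)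
- move=> M N j h inj_j.
  have [|h' h'E] := @linear_exists _ M E h.
    by move=> b x y; rewrite linearP -[b *: h x]/(mul (i b) (h x)) iM.
  have [g gE] := injE h' inj_j.
  have [|g' g'E] := @linear_exists _ N (restr f S^o) g.
    by move=> b x y; rewrite linearP -[b *: (g x : restr f S^o)]/(mul (i b) (g x)) iM.
  by exists g' => x; rewrite /= g'E -h'E -gE.
(* Right multiplication by [f (a t)] and [i \o s t] agree at [i 1], hence everywhere. *)
- move=> t q; exists (s t q).
  rewrite -[LHS]/(r (i (s t (i 1))) q).
  by apply: (endo_eq (r (i (s t (i 1)))) (i \o s t)); rewrite rE.
rewrite -[LHS]/(i 1) [LHS]sP; apply: eq_bigr => t _.
by rewrite -iM.
Qed.

End Envelope.

Theorem corollary4p10 (L : pzRingType) (hL : left_hereditary L)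
    (qL : left_QF3plus L) :
  exists (Q : pzRingType) (f : {rmorphism L -> Q}),
    ring_bimorphism f /\ semisimple_left_artinian Q.
Proof.
have [E [i [[injE essi] projE]]] := qL.
have [Q [f [F [a [inj_f injQ trace unit_sum]]]]] := envelope_ring hL injE essi projE.
exists Q, f; split; first split.
- exact: trace_epimorphism trace unit_sum.
- by move=> T g h gh x; apply: inj_f; apply: gh.
apply: hereditary_selfinjective_semisimple.
  exact: trace_hereditary trace unit_sum inj_f hL.
exact: trace_self_injective trace unit_sum injQ.
Qed.
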